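(* Let $n \geq 2$ be an integer and let $c$ be a positive integer. Then there exists a dimension-critical graph $H$ satisfying $\dim(H) = n+2$ and $|E(H)| > c$.
   Context: All graphs are finite and simple; $E(H)$ denotes the edge set of $H$. A graph $G$ is representable (embeddable) in $\mathbb{R}^n$ if its vertices can be placed at distinct points of $\mathbb{R}^n$ so that any two adjacent vertices are at Euclidean distance exactly 1 (non-adjacent vertices are also allowed to be at distance 1). By convention, $\mathbb{R}^0$ is a single point. The dimension $\dim(G)$ is the smallest integer $n \ge 0$ such that $G$ is representable in $\mathbb{R}^n$. A non-empty graph $G$ is dimension-critical if every proper subgraph $H$ of $G$ (not necessarily induced) satisfies $\dim(H) < \dim(G)$. *)

(* Defs.v *)
From HB Require Import structures.
From mathcomp Require Import all_boot all_order all_algebra.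
From mathcomp Require Import boolp reals.
Set Implicit Arguments.
Unset Strict Implicit.
Unset Printing Implicit Defensive.
Import Order.TTheory GRing.Theory Num.Theory.
Local Open Scope ring_scope.

(* Vertices and edges live in an ambient finite type, so that a subgraph of G
   is again a graph over the same type, with fewer vertices and/or edges. *)
Record graph (T : finType) := Graph {
  vertices : {set T};
  edges : {set {set T}};
  edges_wf : [forall A in edges, (A \subset vertices) && (#|A| == 2)%N]
}.

Definition subgraph (T : finType) (H G : graph T) : Prop :=
  vertices H \subset vertices G /\ edges H \subset edges G.

(* [edges_wf] is a boolean equation, hence proof irrelevant: two graphs are
   equal iff their vertex sets and their edge sets are. *)
Definition proper_subgraph (T : finType) (H G : graph T) : Prop :=
  subgraph H G /\ H <> G.

(* The norm of the library on 'rV[R]_n is the sup norm. *)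
Definition eucl_dist (R : realType) (n : nat) (x y : 'rV[R]_n) : R :=
  Num.sqrt (\sum_(i < n) (x 0 i - y 0 i) ^+ 2).

Definition representable (R : realType) (T : finType) (G : graph T) (n : nat) :
    Prop :=
  exists f : T -> 'rV[R]_n,
    {in vertices G &, injective f} /\
    forall x y : T, [set x; y] \in edges G -> eucl_dist (f x) (f y) = 1.

(* The vectors e_i / sqrt 2 are pairwise at distance 1. *)
Lemma representable_card (R : realType) (T : finType) (G : graph T) :
  representable R G #|T|.
Proof.
pose a : R := (Num.sqrt 2)^-1.
have a0 : a != 0 by rewrite invr_eq0 gt_eqF // sqrtr_gt0.
have a2 : a ^+ 2 = 2^-1 by rewrite exprVn sqr_sqrtr.
pose f (x : T) : 'rV[R]_#|T| := \row_i (a *+ (enum_rank x == i)).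
exists f; split=> [x y _ _ /rowP/(_ (enum_rank x))|x y xyG].
  rewrite !mxE eqxx mulr1n; case: eqP => [/enum_rank_inj-> //|_].
  by rewrite mulr0n => /eqP; rewrite (negPf a0).
have := forall_inP (edges_wf G) _ xyG => /andP[_].
rewrite cards2; case: (eqVneq x y) => // xy _.
have rxy : enum_rank x != enum_rank y by apply: contra xy => /eqP/enum_rank_inj->.
rewrite /eucl_dist (bigD1 (enum_rank x)) //= (bigD1 (enum_rank y)) 1?eq_sym //=.
rewrite big1 => [|i /andP[ix iy]].
  rewrite !mxE !eqxx (negPf rxy) eq_sym (negPf rxy) !mulr0n !mulr1n.
  by rewrite subr0 sub0r sqrrN addr0 a2 -[2^-1]div1r -splitr sqrtr1.
by rewrite !mxE [_ x == i]eq_sym [_ y == i]eq_sym (negPf ix) (negPf iy) subrr expr0n.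
Qed.

Lemma representable_ex (R : realType) (T : finType) (G : graph T) :
  exists n, `[< representable R G n >].
Proof. by exists #|T|; apply/asboolP/representable_card. Qed.

Definition graph_dim (R : realType) (T : finType) (G : graph T) : nat :=
  ex_minn (representable_ex R G).

Definition dimension_critical (R : realType) (T : finType) (G : graph T) :
    Prop :=
  vertices G != set0 /\
  forall H : graph T, proper_subgraph H G -> (graph_dim R H < graph_dim R G)%N.

(* Main.v *)
Require Import Defs.
From mathcomp Require Import all_boot all_order all_algebra.
From mathcomp Require Import boolp reals.
From mathcomp Require Import ring lra zify.

(* The graph is a minimal subgraph, among those not representable in R^(n+1),
   of the join of K_n with a long cycle C_m. In R^(n+1), the points at distance
   1 from the vertices of a unit n-point simplex form a circle on which unit
   chords subtend the angle arccos (1 / (n + 1)). For n >= 2 this is not a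
   rational multiple of 2 pi, so no cycle can be placed on the circle, whereas
   any path can: hence a non-representable subgraph contains all m edges of the
   cycle. In R^(n+2) the circle becomes a 2-sphere, and a path along a great
   circle closes up through one more vertex off that circle as soon as its ends
   are not too far apart. *)

Set Implicit Arguments.
Unset Strict Implicit.
Unset Printing Implicit Defensive.
Import Order.TTheory GRing.Theory Num.Theory.
Local Open Scope ring_scope.

(** * Chebyshev polynomials and the irrationality of the angle arccos (1 / N) *)

(** The Chebyshev polynomial of the first kind T_k at [a]: for a = cos t its value is cos (k t). *)
Fixpoint cheb (R : comNzRingType) (a : R) (k : nat) : R :=
  match k with
  | 0 => 1
  | k1.+1 => match k1 with 0 => a | k2.+1 => 2 * a * cheb a k1 - cheb a k2 end
  end.

Lemma chebSS (R : comNzRingType) (a : R) k :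
  cheb a k.+2 = 2 * a * cheb a k.+1 - cheb a k.
Proof. by []. Qed.

(** The recurrence step preserves this quadratic form. It yields the Pythagorean identity once sines
    are introduced. *)
Lemma cheb_invariant (R : comNzRingType) (a : R) k :
  cheb a k ^+ 2 + cheb a k.+1 ^+ 2 - 2 * a * cheb a k * cheb a k.+1
  = 1 - a ^+ 2.
Proof.
elim: k => [|k IHk]; first by rewrite /=; ring.
by rewrite chebSS -IHk; ring.
Qed.

(** For k >= 1, 2 T_k(a) is a monic integer polynomial of degree k in 2 a, so clearing denominators
    leaves only the leading term modulo [h]. The index is shifted because 2 T_0 = 2 does not fit the
    pattern. *)
Lemma cheb_denominator (R : comNzRingType) (a : R) (g h : int) k :
    2 * a * h%:~R = g%:~R ->
  exists w : int, 2 * cheb a k.+1 * h%:~R ^+ k.+1 = (g ^+ k.+1 + h * w)%:~R.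
Proof.
move=> ah; suff [] : (exists w : int,
    2 * cheb a k.+1 * h%:~R ^+ k.+1 = (g ^+ k.+1 + h * w)%:~R) /\
  (exists w : int,
    2 * cheb a k.+2 * h%:~R ^+ k.+2 = (g ^+ k.+2 + h * w)%:~R) by [].
elim: k => [|k [[w Hw] [w' Hw']]]; split.
- by exists 0; rewrite mulr0 addr0.
- exists (- 2 * h).
  by rewrite expr2 !(intrD, intrM) -ah /=; ring.
- by exists w'.
- exists (g * w' - h * (g ^+ k.+1 + h * w)).
  have -> : 2 * cheb a k.+3 * h%:~R ^+ k.+3 =
      (2 * a * h%:~R) * (2 * cheb a k.+2 * h%:~R ^+ k.+2)
      - h%:~R ^+ 2 * (2 * cheb a k.+1 * h%:~R ^+ k.+1).
    by rewrite chebSS !exprS; ring.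
  rewrite Hw Hw' ah -rmorphXn -!rmorphM -rmorphB /=; congr (_%:~R).
  by rewrite !exprS; ring.
Qed.

(* In lowest terms [2 / N = g / h], and modulo [h] the integer
   [2 * h ^ k * T_k] is the unit [g ^ k]. *)
Lemma cheb_neq1 (R : realFieldType) (N k : nat) :
  (3 <= N)%N -> cheb (N%:R^-1 : R) k.+1 != 1.
Proof.
move=> N3; apply/eqP => Tk.
have N0 : (N%:R : R) != 0 by rewrite pnatr_eq0 -lt0n (ltn_trans _ N3).
(* Lowest terms depend on parity: 2 / N for odd N, 1 / (N / 2) for even N. In both cases N >= 3
   makes the denominator exceed 1. *)
have [g [h [co h1 gh]]] : exists g h : nat,
    [/\ coprime h g, (1 < h)%N & (g * N = 2 * h)%N].
  case: (boolP (odd N)) => oN.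
    exists 2, N; split; rewrite ?(ltn_trans _ N3) //.
    by rewrite coprimen2.
  exists 1%N, N./2; have := odd_double_half N.
  rewrite (negPf oN) add0n coprimen1 => <-; rewrite doubleK mul2n mul1n.
  by split=> //; move: N3; rewrite -{1}(odd_double_half N) (negPf oN) add0n;
    case: (N./2) => [|[|]].
have [|w] := @cheb_denominator R N%:R^-1 g h k.
  rewrite -!pmulrn mulrAC -natrM -gh natrM; exact: mulfK.
rewrite Tk mulr1 -[2]/(2%:~R) -rmorphXn -rmorphM /= => /eqP.
rewrite eqr_int => /eqP E.
have : (h %| g%:Z ^+ k.+1)%Z.
  have -> : g%:Z ^+ k.+1 = h%:Z * (2 * h%:Z ^+ k - w).
    by rewrite mulrBr mulrCA -exprS E addrK.
  exact: dvdz_mulr.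
rewrite dvdzE abszX /= => hg.
have : coprime h (g ^ k.+1) by rewrite coprimeXr.
by rewrite /coprime (gcdn_idPl hg) => /eqP h1'; rewrite h1' in h1.
Qed.

(** The recurrence also runs backwards, so equal consecutive pairs descend until one index is 0.
    There the value is 1, which no later index attains. *)
Lemma cheb_pair_inj (R : realFieldType) (N : nat) : (3 <= N)%N ->
  forall i j, cheb (N%:R^-1 : R) i = cheb N%:R^-1 j ->
    cheb (N%:R^-1 : R) i.+1 = cheb N%:R^-1 j.+1 -> i = j.
Proof.
move=> N3; elim=> [|i IHi] [|j] //.
- by move=> /esym/eqP; rewrite (negPf (cheb_neq1 _ _ N3)).
- by move=> /eqP; rewrite (negPf (cheb_neq1 _ _ N3)).
- move=> E1 E2; congr _.+1; apply: IHi => //.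
  by move: E2; rewrite !chebSS E1 => /addrI/oppr_inj.
Qed.

(** * Inner products and unit simplices *)

Definition dotp (R : comNzRingType) (d : nat) (x y : 'rV[R]_d) : R :=
  (x *m y^T) 0 0.

Lemma dotpC (R : comNzRingType) d (x y : 'rV[R]_d) : dotp x y = dotp y x.
Proof. by rewrite /dotp -[y *m _]trmxK trmx_mul trmxK [in RHS]mxE. Qed.

Lemma dotpDl (R : comNzRingType) d (x y z : 'rV[R]_d) :
  dotp (x + y) z = dotp x z + dotp y z.
Proof. by rewrite /dotp mulmxDl !mxE. Qed.

Lemma dotpBl (R : comNzRingType) d (x y z : 'rV[R]_d) :
  dotp (x - y) z = dotp x z - dotp y z.
Proof. by rewrite /dotp mulmxBl !mxE. Qed.

Lemma dotpBr (R : comNzRingType) d (x y z : 'rV[R]_d) :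
  dotp x (y - z) = dotp x y - dotp x z.
Proof. by rewrite dotpC dotpBl !(dotpC x). Qed.

Lemma dotp_distC (R : comNzRingType) d (x y : 'rV[R]_d) :
  dotp (x - y) (x - y) = dotp (y - x) (y - x).
Proof. by rewrite -opprB /dotp linearN mulNmx mulmxN opprK. Qed.

Lemma dotp_subr_sqr (R : comNzRingType) d (x y : 'rV[R]_d) :
  dotp (x + y) (x - y) = dotp x x - dotp y y.
Proof. by rewrite dotpBr !dotpDl (dotpC y x); ring. Qed.

Lemma dotp_eq0 (R : realFieldType) d (x : 'rV[R]_d) :
  (dotp x x == 0) = (x == 0).
Proof.
apply/eqP/eqP => [|->]; last by rewrite /dotp mul0mx mxE.
rewrite /dotp mxE => /eqP; rewrite psumr_eq0; last first.
  by move=> i _; rewrite mxE -expr2 sqr_ge0.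
move=> /allP x0; apply/rowP => i; have := x0 i (mem_index_enum _).
by rewrite !mxE -expr2 sqrf_eq0 => /eqP.
Qed.

Lemma eucl_dist_eq1 (R : realType) d (x y : 'rV[R]_d) :
  (eucl_dist x y = 1) <-> (dotp (x - y) (x - y) = 1).
Proof.
have -> : dotp (x - y) (x - y) = \sum_(i < d) (x 0 i - y 0 i) ^+ 2.
  by rewrite /dotp mxE; apply: eq_bigr => i _; rewrite !mxE -expr2.
rewrite /eucl_dist; split=> [E|->]; last by rewrite sqrtr1.
rewrite -[LHS]sqr_sqrtr ?E ?expr1n //.
by apply: sumr_ge0 => i _; rewrite sqr_ge0.
Qed.

Lemma equilateral_dotp (R : realFieldType) d (x y z : 'rV[R]_d) :
    dotp (x - y) (x - y) = 1 -> dotp (x - z) (x - z) = 1 ->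
    dotp (y - z) (y - z) = 1 ->
  dotp (x - z) (y - z) = 2^-1.
Proof.
rewrite !dotpBl !dotpBr (dotpC y x) (dotpC z x) (dotpC z y) => h1 h2 h3.
by lra.
Qed.

(** With J the all-ones matrix, J^2 = n J makes [B] an explicit inverse of (1 + J) / 2. *)
Lemma unit_det_gram (R : realFieldType) n (E : 'M[R]_(n, n.+1)) :
    E *m E^T = 2^-1 *: (1%:M + const_mx 1) ->
  E *m E^T \in unitmx.
Proof.
move=> EE; set B : 'M[R]_n := 2 *: (1%:M - n.+1%:R^-1 *: const_mx 1).
have n0 : (n.+1%:R : R) != 0 by rewrite pnatr_eq0.
suff /mulmx1_unit[] : E *m E^T *m B = 1%:M by [].
pose J : 'M[R]_n := const_mx 1.
have JJ : J *m J = n%:R *: J.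
  apply/matrixP => i j; rewrite !mxE mulr1.
  under eq_bigr do rewrite !mxE mulr1.
  by rewrite sumr_const card_ord.
rewrite EE /B -scalemxAr -scalemxAl scalerA divff ?pnatr_eq0 // scale1r.
rewrite mulmxBr mulmx1 -scalemxAr mulmxDl mul1mx -/J JJ -addrA.
rewrite -[RHS]addr0; congr (_ + _).
rewrite -[X in _ *: (X + _)]scale1r -scalerDl scalerA -{1}[J]scale1r.
by rewrite -scalerBl nat1r mulVf // subrr scale0r.
Qed.

(* The rows of [E] together with [D] and [Z] would be [n.+2] independent
   vectors of a space of dimension [n.+1]. *)
Lemma orthogonal_line (R : realFieldType) n (E : 'M[R]_(n, n.+1))
    (D Z : 'rV[R]_n.+1) :
    E *m E^T \in unitmx -> E *m D^T = 0 -> E *m Z^T = 0 -> dotp D Z = 0 ->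
  D != 0 -> Z = 0.
Proof.
move=> EE ED EZ DZ D0; apply/eqP; apply: contraT => Z0.
have DZ0 : D *m Z^T = 0 by apply/matrixP => i j; rewrite !ord1 [LHS]DZ mxE.
pose A := col_mx E (col_mx D Z).
(* By orthogonality this Gram matrix is block triangular with invertible diagonal blocks, so [A]
   would have rank n + 2 with only n + 1 columns. *)
have : A *m A^T \in unitmx.
  rewrite /A !tr_col_mx mul_col_row mul_mx_row ED EZ row_mx0.
  rewrite unitmxE det_lblock unitrM -unitmxE EE /=.
  rewrite mul_col_row DZ0 det_lblock unitrM !det_mx11.
  by rewrite !unitfE !dotp_eq0 D0.
move=> /mxrank_unit rA; have := mxrankM_maxl A A^T.
by rewrite rA => /leq_trans/(_ (rank_leq_col A)); rewrite addnC ltnn.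
Qed.

(* [u] and [w] are the two points completing the simplex on [p] and [v]. *)
Lemma simplex_reflection (R : realFieldType) n (p : 'I_n -> 'rV[R]_n.+1)
    (u v w : 'rV[R]_n.+1) :
    (forall i j, i != j -> dotp (p i - p j) (p i - p j) = 1) ->
    (forall i, dotp (p i - u) (p i - u) = 1) ->
    (forall i, dotp (p i - v) (p i - v) = 1) ->
    (forall i, dotp (p i - w) (p i - w) = 1) ->
    dotp (u - v) (u - v) = 1 -> dotp (w - v) (w - v) = 1 -> u != w ->
  u + w = (2 / n.+1%:R) *: (v + \sum_i p i).
Proof.
move=> pp pu pv pw uv wv uw.
have n0 : (n.+1%:R : R) != 0 by rewrite pnatr_eq0.
pose E := \matrix_(i < n) (p i - v).
pose one : 'rV[R]_n := const_mx 1.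
have dotE (x y : 'rV[R]_n.+1) i : (E *m x^T) i 0 = dotp (p i - v) x.
  by rewrite /dotp !mxE; apply: eq_bigr => k _; rewrite !mxE.
have EE : E *m E^T = 2^-1 *: (1%:M + const_mx 1).
  apply/matrixP => i j.
  have -> : (E *m E^T) i j = dotp (p i - v) (p j - v).
    by rewrite /dotp !mxE; apply: eq_bigr => k _; rewrite !mxE.
  rewrite !mxE; case: (eqVneq i j) => [<-|ij].
    by rewrite pv mulr1n -(mulr2n 1) mulVf ?pnatr_eq0.
  by rewrite mulr0n add0r mulr1 equilateral_dotp ?pp.
have Esum : one *m E = \sum_i p i - n%:R *: v.
  apply/rowP => j; rewrite !mxE summxE.
  under eq_bigr do rewrite !mxE mul1r.
  by rewrite sumrB sumr_const card_ord mulr_natl.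
have E1 (x : 'rV[R]_n.+1) : (forall i, dotp (p i - x) (p i - x) = 1) ->
    dotp (x - v) (x - v) = 1 -> E *m (x - v)^T = 2^-1 *: one^T.
  move=> px xv; apply/colP => i; rewrite dotE // !mxE mulr1.
  by apply: equilateral_dotp.
have Eone : E *m (one *m E)^T = (2^-1 * n.+1%:R) *: one^T.
  rewrite trmx_mul mulmxA EE -scalemxAl mulmxDl mul1mx -scalerA; congr (_ *: _).
  apply/colP => i; rewrite !mxE mulr1; under eq_bigr do rewrite !mxE mulr1.
  by rewrite sumr_const card_ord -natr1 addrC.
(* This value gives [c *: (one *m E)] the product 1 = 1/2 + 1/2 with each row of [E], the same as
   [(u - v) + (w - v)]. *)
set c := 2 / n.+1%:R.
have Zeq : u + w - c *: (v + \sum_i p i) = (u - v) + (w - v) - c *: (one *m E).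
  have cn : c * n.+1%:R = 2 by rewrite /c divfK.
  rewrite Esum; apply/rowP => j; rewrite !mxE; move: cn; rewrite -natr1 => cn.
  by move: (congr1 ( *%R^~ (v 0 j)) cn) => /=; lra.
(* The difference of the two sides is orthogonal to the rows of [E] by the choice of [c], and to
   [u - w] because [u] and [w] are equally far from [v]. Hence it vanishes. *)
apply/eqP; rewrite -subr_eq0; apply/eqP.
have DE : (u - v) - (w - v) = u - w by rewrite opprB addrA subrK.
have ED : E *m (u - w)^T = 0.
  by rewrite -DE linearB /= mulmxBr !E1 // subrr.
apply: (@orthogonal_line _ _ E (u - w)) => //.
- by apply: unit_det_gram.
- rewrite Zeq [(_ - _)^T]raddfB /= mulmxBr.
  rewrite [(_ + (w - v))^T]raddfD /= mulmxDr !E1 //.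
  rewrite linearZ /= -scalemxAr Eone -scalerDl scalerA /c mulrCA divfK //.
  by rewrite -[2^-1]div1r -splitr mul1r mulVf ?pnatr_eq0 // subrr.
- rewrite Zeq -DE dotpC dotpBl.
  have -> : dotp (c *: (one *m E)) (u - v - (w - v)) = 0.
    by rewrite /dotp -scalemxAl -mulmxA DE ED mulmx0 scaler0 mxE.
  by rewrite dotp_subr_sqr uv wv subrr subr0.
- by rewrite subr_eq0.
Qed.

(** * Closed walks of unit chords on the circle *)

(** The analogue of cos ((k + i) t) + cos ((k - i) t) = 2 cos (i t) cos (k t) for any vector
    solution of the recurrence. *)
Lemma cheb_symmetric_sum (R : comNzRingType) (V : lmodType R) (a : R)
    (y : nat -> V) :
    (forall i, y i + y i.+2 = (2 * a) *: y i.+1) ->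
  forall k i, (i <= k)%N -> y (k + i)%N + y (k - i)%N = (2 * cheb a i) *: y k.
Proof.
move=> rec k; have recr i : y i.+2 = (2 * a) *: y i.+1 - y i.
  by rewrite -rec addrAC subrr add0r.
have recl i : y i = (2 * a) *: y i.+1 - y i.+2 by rewrite -rec addrK.
suff: forall i,
   ((i <= k)%N -> y (k + i)%N + y (k - i)%N = (2 * cheb a i) *: y k)
   /\ ((i < k)%N -> y (k + i.+1)%N + y (k - i.+1)%N = (2 * cheb a i.+1) *: y k).
  by move=> h i /(proj1 (h i)).
elim=> [|i [IH1 IH2]]; split=> ik.
- by rewrite addn0 subn0 mulr1 scaler_nat.
- case: k ik {recr recl} => // k _.
  by rewrite addn1 subn1 /= addrC rec.
- exact: IH2.
- have ik1 := ltnW ik; have ik2 := ltnW ik1.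
  have kE1 : (k - i.+2).+1 = (k - i.+1)%N by rewrite subnS prednK ?subn_gt0.
  have kE : (k - i.+2).+2 = (k - i)%N by rewrite kE1 subnS prednK ?subn_gt0.
  rewrite !addnS recr [y (k - _)%N]recl kE kE1 -addnS addrACA -scalerDr.
  rewrite IH2 // -opprD IH1 // scalerA -scalerBl chebSS; congr (_ *: _); ring.
Qed.

(** About the centre [c] of the simplex, the points satisfy the Chebyshev recurrence with a = 1 / (n
    + 1). Period m turns the symmetric sum into 2 y_k = 2 T_m(a) y_k; as T_m(a) differs from 1, y_k
    = 0 for all k >= m, against the unit steps. *)
Lemma no_simplex_cycle (R : realFieldType) n m (p : 'I_n -> 'rV[R]_n.+1)
    (x : nat -> 'rV[R]_n.+1) :
    (2 <= n)%N -> (0 < m)%N ->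
    (forall i j, i != j -> dotp (p i - p j) (p i - p j) = 1) ->
    (forall i j, dotp (p i - x j) (p i - x j) = 1) ->
    (forall i, x (i + m)%N = x i) ->
    (forall i, dotp (x i.+1 - x i) (x i.+1 - x i) = 1) ->
    (forall i, x i != x i.+2) -> False.
Proof.
move=> n2 m0 pp px xm xx xneq.
have n0 : (n%:R : R) != 0 by rewrite pnatr_eq0 -lt0n ltnW.
have N0 : (n.+1%:R : R) != 0 by rewrite pnatr_eq0.
pose a : R := n.+1%:R^-1; pose c := n%:R^-1 *: \sum_i p i.
have sumE : \sum_i p i = n%:R *: c by rewrite scalerA divff // scale1r.
pose y i := x i - c.
have rec i : y i + y i.+2 = (2 * a) *: y i.+1.
  rewrite /y addrACA -opprD (@simplex_reflection _ _ p (x i) (x i.+1)) //.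
  - rewrite sumE -/a [in RHS]scalerBr scalerDr -addrA; congr (_ + _).
    rewrite -mulr2n -scaler_nat scalerA -scalerBl -scaleNr; congr (_ *: _).
    have : a * n.+1%:R = 1 by rewrite mulVf.
    by rewrite -natr1; lra.
  - by rewrite dotp_distC; exact: xx.
have ym i : y (i + m)%N = y i by rewrite /y xm.
have y0 k : (m <= k)%N -> y k = 0.
  move=> mk; have := cheb_symmetric_sum rec mk.
  rewrite ym -[y (k - m)%N]ym subnK // -mulr2n -scaler_nat => /eqP.
  rewrite -subr_eq0 -scalerBl scaler_eq0 => /orP[|/eqP //].
  rewrite -{1}[2]mulr1 -mulrBr mulf_eq0 pnatr_eq0 /= subr_eq0 eq_sym.
  by case: m m0 {xm ym mk} => // m _; rewrite (negPf (cheb_neq1 _ _ _)).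
have := xx m; rewrite -[x m](subrK c) -[x m.+1](subrK c) -!/(y _) !y0 //.
by rewrite subrr /dotp mul0mx mxE => /eqP; rewrite eq_sym oner_eq0.
Qed.

(** * The join of a complete graph and a cycle *)

Definition graph_of_rel_edges (T : finType) (e : rel T) : {set {set T}} :=
  [set A : {set T} | [exists x, exists y, e x y && (A == [set x; y])]].

Lemma graph_of_rel_wf (T : finType) (e : rel T) : irreflexive e ->
  [forall A in graph_of_rel_edges e,
     (A \subset [set: T]) && (#|A| == 2)%N].
Proof.
move=> irr; apply/forall_inP => A; rewrite inE subsetT.
move=> /existsP[x /existsP[y /andP[exy /eqP->]]].
by rewrite cards2; case: (eqVneq x y) exy => // ->; rewrite irr.
Qed.

Definition graph_of_rel (T : finType) (e : rel T) (irr : irreflexive e) :=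
  Graph (graph_of_rel_wf irr).

Lemma graph_of_relE (T : finType) (e : rel T) (irr : irreflexive e) x y :
  symmetric e -> ([set x; y] \in edges (graph_of_rel irr)) = e x y.
Proof.
move=> sym; rewrite inE; apply/existsP/idP => [[u /existsP[v /andP[euv]]]|exy].
  rewrite eqEsubset !subUset !sub1set !inE => /andP[/andP[]].
  move=> /orP[]/eqP-> /orP[]/eqP->; rewrite ?irr ?orbb.
  - by move=> /andP[_ /eqP E]; rewrite -E irr in euv.
  - by [].
  - by rewrite sym.
  - by move=> /andP[/eqP E _]; rewrite -E irr in euv.
by exists x; apply/existsP; exists y; rewrite exy eqxx.
Qed.

(** [inl] carries the clique K_n and [inr] the rim, a cycle of length k + 1. The conjunct [i != j]
    keeps the relation irreflexive at k = 0, where [ordS] is the identity. *)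
Definition join_cycle_rel n k (u v : 'I_n + 'I_k.+1) : bool :=
  match u, v with
  | inl i, inl j => i != j
  | inr i, inr j => (i != j) && ((j == ordS i) || (i == ordS j))
  | _, _ => true
  end.

Lemma join_cycle_irr n k : irreflexive (@join_cycle_rel n k).
Proof. by case=> i /=; rewrite eqxx. Qed.

Lemma join_cycle_sym n k : symmetric (@join_cycle_rel n k).
Proof. by move=> [i|i] [j|j] //=; rewrite eq_sym // orbC. Qed.

Definition join_cycle n k := graph_of_rel (@join_cycle_irr n k).

Lemma inZpS k i : inZp i.+1 = ordS (inZp i : 'I_k.+1).
Proof. by apply: val_inj; rewrite /= -addn1 -[(i %% _).+1]addn1 modnDml. Qed.

Lemma inZp_addn_neq k i d : (0 < d <= k)%N ->
  inZp (i + d) != inZp i :> 'I_k.+1.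
Proof.
move=> /andP[d0 dk]; apply/eqP => /(congr1 val)/eqP /=.
by rewrite -{2}[i]addn0 eqn_modDl mod0n modn_small // eqn0Ngt d0.
Qed.

(** The rim is unrolled into a periodic sequence by [inZp]. Length at least 3 separates vertices two
    steps apart. *)
Lemma join_cycle_not_representable (R : realType) n k :
  (2 <= n)%N -> (2 <= k)%N -> ~ representable R (join_cycle n k) n.+1.
Proof.
move=> n2 k2 [f [finj fE]].
have finj' : injective f by move=> u v; apply: finj; rewrite inE.
have {}fE u v : join_cycle_rel u v -> dotp (f u - f v) (f u - f v) = 1.
  move=> uv; apply/eucl_dist_eq1/fE; rewrite graph_of_relE //.
  exact: join_cycle_sym.
apply: (@no_simplex_cycle R n k.+1 (f \o inl)
  (fun i => f (inr (inZp i)))) => //.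
- by move=> i j ij; apply: fE.
- by move=> i j; apply: fE.
- by move=> i; congr (f (inr _)); apply: val_inj; rewrite /= modnDr.
- move=> i; apply: fE => /=; rewrite inZpS eqxx orbT andbT -inZpS.
  by have := @inZp_addn_neq k i 1 (ltnW k2); rewrite (addn1 i).
- move=> i; apply: contraTneq (@inZp_addn_neq k i 2 k2) => /finj'[] E.
  by rewrite (addn2 i) -val_eqE /= E eqxx.
Qed.

(** * Placing the join around the centre of the simplex *)

Lemma dotp_row_mx (R : comNzRingType) n d (x y : 'rV[R]_n) (u v : 'rV[R]_d) :
  dotp (row_mx x u) (row_mx y v) = dotp x y + dotp u v.
Proof. by rewrite /dotp tr_row_mx mul_row_col mxE. Qed.

Lemma dotp_const (R : comNzRingType) n (s t : R) :
  dotp (const_mx s : 'rV_n) (const_mx t) = n%:R * (s * t).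
Proof.
rewrite /dotp mxE; under eq_bigr do rewrite !mxE.
by rewrite sumr_const card_ord mulr_natl.
Qed.

Lemma dotp_delta (R : comNzRingType) n (a : R) (i : 'I_n) (x : 'rV_n) :
  dotp (a *: delta_mx 0 i) x = a * x 0 i.
Proof.
rewrite /dotp -scalemxAl mxE mxE (bigD1 i) //= big1 => [|j ji].
  by rewrite !mxE !eqxx mul1r addr0.
by rewrite !mxE (negPf ji) mul0r.
Qed.

(* [K_n] is placed at the points [e_j / sqrt 2] of the first factor; the points
   at distance 1 from all of them form a sphere about the centre of the simplex
   in the span of [(1, ..., 1)] and of the second factor. *)
Lemma join_cycle_representable (R : realType) n k d
    (H : graph ('I_n + 'I_k.+1)%type)
    (X : 'I_k.+1 -> R) (Y : 'I_k.+1 -> 'rV[R]_d) :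
    (0 < n)%N -> subgraph H (join_cycle n k) ->
    (forall i, X i ^+ 2 + dotp (Y i) (Y i) = n.+1%:R / (2 * n%:R)) ->
    (forall i j, X i = X j -> Y i = Y j -> i = j) ->
    (forall i, [set inr i; inr (ordS i)] \in edges H ->
       X i * X (ordS i) + dotp (Y i) (Y (ordS i)) = (2 * n%:R)^-1) ->
  representable R H (n + d).
Proof.
move=> n_gt0 [_ HG] XY XYinj XYE.
have n0 : (n%:R : R) != 0 by rewrite pnatr_eq0 -lt0n.
pose a : R := (Num.sqrt 2)^-1; pose t : R := (Num.sqrt n%:R)^-1.
have a2 : a ^+ 2 = 2^-1 by rewrite exprVn sqr_sqrtr.
have t2 : n%:R * t ^+ 2 = 1 by rewrite exprVn sqr_sqrtr ?ler0n // mulfV.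
have t0 : t != 0 by rewrite invr_eq0 gt_eqF // sqrtr_gt0 ltr0n.
(* [a / n] is each coordinate of the centroid of the simplex and [t] normalises (1, ..., 1), so [x]
   is the signed offset from the centroid along that direction. *)
pose s x : R := a / n%:R + x * t.
pose f (u : 'I_n + 'I_k.+1) : 'rV[R]_(n + d) := match u with
  | inl j => row_mx (a *: delta_mx 0 j) 0
  | inr i => row_mx (const_mx (s (X i))) (Y i) end.
have dot0 (x : 'rV[R]_d) : dotp 0 x = 0 by rewrite /dotp mul0mx mxE.
have dpp i j : dotp (f (inl i)) (f (inl j)) = 2^-1 *+ (i == j).
  by rewrite dotp_row_mx dot0 addr0 dotp_delta !mxE eqxx /= eq_sym mulr_natr
             mulrnAr -expr2 a2.
have dpx i j : dotp (f (inl i)) (f (inr j)) = a * s (X j).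
  by rewrite dotp_row_mx dot0 addr0 dotp_delta !mxE.
have dxx i j : dotp (f (inr i)) (f (inr j)) =
    n%:R * (s (X i) * s (X j)) + dotp (Y i) (Y j).
  by rewrite dotp_row_mx dotp_const.
have dist_pp i j : i != j ->
    dotp (f (inl i) - f (inl j)) (f (inl i) - f (inl j)) = 1.
  move=> ij; rewrite !dotpBl !dotpBr !dpp !eqxx [j == i]eq_sym (negPf ij).
  by rewrite mulr0n mulr1n; lra.
(* The centroid is at squared distance (n - 1) / (2 n) from the simplex vertices, which leaves (n +
   1) / (2 n) for the squared radius of the sphere. *)
have dist_px i j : dotp (f (inl i) - f (inr j)) (f (inl i) - f (inr j)) = 1.
  rewrite !dotpBl !dotpBr dpp eqxx mulr1n (dotpC (f (inr j))) dpx dxx.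
  have /(canRL (addKr _)) -> := XY j.
  transitivity (2^-1 - a ^+ 2 / n%:R + X j ^+ 2 * (n%:R * t ^+ 2)
                - X j ^+ 2 + (n%:R + 1) / (2 * n%:R)).
    by rewrite /s -natr1; field.
  by rewrite a2 t2; field.
have dist_xx i j : X i * X j + dotp (Y i) (Y j) = (2 * n%:R)^-1 ->
    dotp (f (inr i) - f (inr j)) (f (inr i) - f (inr j)) = 1.
  rewrite !dotpBl !dotpBr (dotpC (f (inr j))) !dxx.
  move=> /(canRL (addKr _)) ->.
  have /(canRL (addKr _)) -> := XY i; have /(canRL (addKr _)) -> := XY j.
  transitivity ((X i - X j) ^+ 2 * (n%:R * t ^+ 2) - (X i - X j) ^+ 2 + 1).
    by rewrite /s -natr1; field.
  by rewrite t2; ring.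
(* Distance 1 forces distinctness, so injectivity needs a separate argument only between two rim
   vertices. *)
have neq1 u v : dotp (f u - f v) (f u - f v) = 1 -> f u <> f v.
  move=> uv E; move: uv; rewrite E subrr /dotp mul0mx mxE => /eqP.
  by rewrite eq_sym oner_eq0.
exists f; split.
  move=> [i|i] [j|j] _ _.
  - by case: (eqVneq i j) => [->//|/dist_pp/neq1].
  - by move/neq1: (dist_px i j).
  - by move=> /esym E; case: (neq1 _ _ (dist_px j i)).
  - move=> /eq_row_mx[/rowP E EY]; congr inr; apply: XYinj => //.
    have := E (Ordinal n_gt0); rewrite !mxE => /addrI.
    exact: mulIf.
move=> u v uvH; apply/eucl_dist_eq1.
have := subsetP HG _ uvH; rewrite graph_of_relE; last exact: join_cycle_sym.
case: u v uvH => [i|i] [j|j] uvH //=; first exact: dist_pp.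
  by move=> _; exact: dist_px.
  by move=> _; rewrite dotp_distC; exact: dist_px.
move=> /andP[_ /orP[]/eqP E].
  by apply: dist_xx; rewrite E; apply: XYE; rewrite -E.
by apply: dist_xx; rewrite E mulrC dotpC; apply: XYE; rewrite -E setUC.
Qed.

(** * Paths and cycles on the unit sphere *)

(* With [a = cos t], these are [cos (k t)] and [sin (k t)]. *)
Definition cheb_sin (R : rcfType) (a : R) (k : nat) : R :=
  (a * cheb a k - cheb a k.+1) / Num.sqrt (1 - a ^+ 2).

Lemma cheb_circle (R : rcfType) (a : R) k : a ^+ 2 < 1 ->
  cheb a k ^+ 2 + cheb_sin a k ^+ 2 = 1.
Proof.
rewrite -subr_gt0 => a1; have b0 := lt0r_neq0 a1.
rewrite /cheb_sin expr_div_n sqr_sqrtr ?ltW //.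
apply: (mulIf b0); rewrite mulrDl divfK // mul1r -(cheb_invariant a k).
by have := cheb_invariant a k; nra.
Qed.

(** The angles k t and (k + 1) t differ by t; after clearing the denominator this is
    [cheb_invariant]. *)
Lemma cheb_chord (R : rcfType) (a : R) k : a ^+ 2 < 1 ->
  cheb a k * cheb a k.+1 + cheb_sin a k * cheb_sin a k.+1 = a.
Proof.
rewrite -subr_gt0 => a1; have b0 := lt0r_neq0 a1.
rewrite /cheb_sin mulrACA -invfM -expr2 sqr_sqrtr ?ltW //.
apply: (mulIf b0); rewrite mulrDl divfK // chebSS.
by rewrite -[in RHS](cheb_invariant a k); ring.
Qed.

(** The cosine and sine at an index determine the cosine at the next one, which reduces the claim to
    [cheb_pair_inj]. *)
Lemma cheb_circle_inj (R : rcfType) (N i j : nat) : (3 <= N)%N ->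
    cheb (N%:R^-1 : R) i = cheb N%:R^-1 j ->
    cheb_sin (N%:R^-1 : R) i = cheb_sin N%:R^-1 j -> i = j.
Proof.
move=> N3 E; rewrite /cheb_sin E => /mulIf E2.
apply: (cheb_pair_inj N3 E); apply/oppr_inj/(addrI (N%:R^-1 * cheb N%:R^-1 j)).
apply: E2; rewrite invr_eq0 gt_eqF // sqrtr_gt0 subr_gt0 exprVn.
rewrite invf_lt1 ?exprn_gt0 ?ltr0n ?(ltn_trans _ N3) //.
by rewrite -natrX ltr1n; nia.
Qed.

Lemma invn_sqr_lt1 (R : realFieldType) (N : nat) : (2 <= N)%N ->
  (N%:R^-1 : R) ^+ 2 < 1.
Proof.
move=> N2; rewrite exprVn invf_lt1 ?exprn_gt0 ?ltr0n ?(ltn_trans _ N2) //.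
by rewrite -natrX ltr1n; nia.
Qed.

(** Scaling by the radius r, with r^2 = (n + 1) / (2 n), turns the cosine 1 / (n + 1) into the inner
    product 1 / (2 n) of points at distance 1. *)
Lemma unit_sphere_representable (R : realType) n k d
    
    (H : graph ('I_n + 'I_k.+1)%type)
    (X : 'I_k.+1 -> R) (Y : 'I_k.+1 -> 'rV[R]_d) :
    (0 < n)%N -> subgraph H (join_cycle n k) ->
    (forall i, X i ^+ 2 + dotp (Y i) (Y i) = 1) ->
    (forall i j, X i = X j -> Y i = Y j -> i = j) ->
    (forall i, [set inr i; inr (ordS i)] \in edges H ->
       X i * X (ordS i) + dotp (Y i) (Y (ordS i)) = n.+1%:R^-1) ->
  representable R H (n + d).
Proof.
move=> n_gt0 HG XY XYinj XYE.
have n0 : (n%:R : R) != 0 by rewrite pnatr_eq0 -lt0n.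
pose r : R := Num.sqrt (n.+1%:R / (2 * n%:R)).
have r2 : r ^+ 2 = n.+1%:R / (2 * n%:R).
  by rewrite sqr_sqrtr // divr_ge0 ?mulr_ge0 ?ler0n.
have r0 : r != 0.
  by rewrite -sqrf_eq0 r2 mulf_eq0 invr_eq0 mulf_eq0 (negPf n0) !pnatr_eq0.
have dotZ i j : dotp (r *: Y i) (r *: Y j) = r ^+ 2 * dotp (Y i) (Y j).
  by rewrite /dotp linearZ /= -scalemxAl -scalemxAr scalerA mxE.
apply: (@join_cycle_representable _ _ _ _ _ (fun i => r * X i)
  (fun i => r *: Y i)) => // [i|i j|i iH].
- by rewrite dotZ exprMn -mulrDr XY mulr1.
- by move=> /(mulfI r0) E1 /(scalerI r0); exact: XYinj.
- rewrite dotZ mulrACA -expr2 -mulrDr XYE //.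
  by rewrite r2 mulrAC divff ?pnatr_eq0 ?mul1r.
Qed.

Lemma path_representable (R : realType) n k (H : graph ('I_n + 'I_k.+1)%type)
    (j : 'I_k.+1) :
    (2 <= n)%N -> subgraph H (join_cycle n k) ->
    [set inr j; inr (ordS j)] \notin edges H ->
  representable R H (n + 1).
Proof.
move=> n2 HG jH.
pose a : R := n.+1%:R^-1.
have a1 : a ^+ 2 < 1 by apply: invn_sqr_lt1; rewrite ltnW.
(* The cycle is cut at the missing edge: [pos] counts steps from [ordS j], at position 0, round to
   [j], at position k. *)
pose pos (i : 'I_k.+1) := if (i <= j)%N then (i + (k - j))%N else (i - j.+1)%N.
have pos_inj : injective pos.
  move=> u v; rewrite /pos; have := ltn_ord u; have := ltn_ord v.
  by move=> hu hv h; apply: ord_inj; move: h; case: ifP; case: ifP; lia.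
have posS i : i != j -> pos (ordS i) = (pos i).+1.
  rewrite /pos -val_eqE /=; have := ltn_ord i; have := ltn_ord j.
  case: (ltnP i k) => [ik|ki] hj hi ij.
    by rewrite modn_small //; case: (ltngtP i j) ij => // ij _; lia.
  have -> : nat_of_ord i = k by lia.
  by rewrite modnn leq0n; case: leqP; lia.
apply: (@unit_sphere_representable _ _ _ _ _ (fun i => cheb a (pos i))
  (fun i => const_mx (cheb_sin a (pos i)))) => // [|i|i i'|i iH].
- by rewrite ltnW.
- by rewrite dotp_const mul1r -expr2 cheb_circle.
- move=> E1 /rowP/(_ 0); rewrite !mxE => E2.
  by apply: pos_inj; apply: cheb_circle_inj E1 E2.
- rewrite dotp_const mul1r posS ?cheb_chord //.
  by apply: contraNneq jH => <-.
Qed.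

(** Rim vertices 0 to k sit on a great circle at angles i t; vertex k + 1 closes the cycle from off
    that circle. The strict bound makes its height nonzero, hence the point new. *)
Lemma cycle_representable (R : realType) n k (H : graph ('I_n + 'I_k.+2)%type) :
    (2 <= n)%N -> subgraph H (join_cycle n k.+1) ->
    2 * n.+1%:R^-1 ^+ 2 < 1 + cheb (n.+1%:R^-1 : R) k ->
  representable R H (n + 2).
Proof.
move=> n2 HG.
set a : R := n.+1%:R^-1.
have a1 : a ^+ 2 < 1 by apply: invn_sqr_lt1; rewrite ltnW.
move=> Ck; set C := cheb a k in Ck; pose S := cheb_sin a k.
have CS : C ^+ 2 + S ^+ 2 = 1 := cheb_circle k a1.
have C1 : 0 < 1 + C by rewrite (le_lt_trans _ Ck) // mulr_ge0 ?sqr_ge0.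
have C0 : 1 + C != 0 by rewrite gt_eqF.
(* The closing point is (al (1 + C), al S, be). Its products with the ends (1, 0, 0) and (C, S, 0)
   are both al (1 + C) = a, and [be] completes its norm to 1. *)
pose al := a / (1 + C); pose be := Num.sqrt (1 - 2 * a ^+ 2 / (1 + C)).
have be0 : 0 < 1 - 2 * a ^+ 2 / (1 + C).
  by rewrite subr_gt0 ltr_pdivrMr ?mul1r.
have be2 : be ^+ 2 = 1 - 2 * a ^+ 2 / (1 + C) by rewrite sqr_sqrtr // ltW.
have be_neq0 : be != 0 by rewrite gt_eqF // sqrtr_gt0.
have S2 : S ^+ 2 = 1 - C ^+ 2 by rewrite -CS addrAC subrr add0r.
pose x (i : nat) : R := if (i <= k)%N then cheb a i else al * (1 + C).
pose y (i : nat) : R := if (i <= k)%N then cheb_sin a i else al * S.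
pose z (i : nat) : R := if (i <= k)%N then 0 else be.
have norm i : x i ^+ 2 + y i ^+ 2 + z i ^+ 2 = 1.
  rewrite /x /y /z; case: ifP => _; first by rewrite expr0n addr0 cheb_circle.
  by rewrite be2 ![(al * _) ^+ 2]exprMn S2 /al; field.
have chord (i : 'I_k.+2) :
    x i * x (ordS i) + y i * y (ordS i) + z i * z (ordS i) = a.
  have := ltn_ord i; rewrite ltnS leq_eqVlt => /orP[/eqP iE|ik].
    have oE : ordS i = 0 :> nat by rewrite /= iE modnn.
    have sin0 : cheb_sin a 0 = 0 by rewrite /cheb_sin mulr1 subrr mul0r.
    by rewrite /x /y /z oE iE ltnn leq0n sin0 !mulr0 mulr1 !addr0 /al divfK.
  have oE : ordS i = i.+1 :> nat by rewrite /= modn_small.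
  move: ik; rewrite /x /y /z oE ltnS => ik; rewrite ik mul0r addr0.
  move: ik; rewrite leq_eqVlt => /orP[/eqP->|ik]; last by rewrite ik cheb_chord.
  by rewrite ltnn -/C -/S [S * _]mulrCA -expr2 S2 /al; field.
pose Y i : 'rV[R]_(1 + 1) := row_mx (const_mx (y i)) (const_mx (z i)).
have YE i j : dotp (Y i) (Y j) = y i * y j + z i * z j.
  by rewrite dotp_row_mx !dotp_const !mul1r.
apply: (@unit_sphere_representable _ _ _ _ _ x Y) => // [|i|i j|i _].
- by rewrite ltnW.
- by rewrite YE -!expr2 addrA norm.
- move=> E1 /eq_row_mx[/rowP/(_ 0) E2 /rowP/(_ 0) E3].
  move: E2 E3; rewrite !mxE => E2 E3; apply: ord_inj.
  move: E1 E2 E3; rewrite /x /y /z; case: ifP => hi; case: ifP => hj E1 E2 E3.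
  + by apply: cheb_circle_inj E1 E2.
  + by rewrite -E3 eqxx in be_neq0.
  + by rewrite E3 eqxx in be_neq0.
  + by have := ltn_ord i; have := ltn_ord j; lia.
- by rewrite YE addrA chord.
Qed.

(** If k fails, then T_k <= 2 a^2 - 1, and T_{k+2} = 2 a T_{k+1} - T_k >= 1 - 2 a - 2 a^2. Since a
    <= 1/3, index k + 2 succeeds. *)
Lemma cheb_lower_bound (R : rcfType) (N k : nat) : (3 <= N)%N ->
  exists2 m, (k <= m)%N & 2 * N%:R^-1 ^+ 2 < 1 + cheb (N%:R^-1 : R) m.
Proof.
move=> N3; set a : R := N%:R^-1.
have a0 : 0 < a by rewrite invr_gt0 ltr0n (ltn_trans _ N3).
have a3 : a <= 3^-1.
  by rewrite lef_pV2 ?posrE ?ler_nat // ltr0n (ltn_trans _ N3).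
have [h|h] := ltP (2 * a ^+ 2) (1 + cheb a k); first by exists k.
exists k.+2; first by rewrite leqW // leqW.
have C1 : -1 <= cheb a k.+1.
  have := @cheb_circle R a k.+1; have := sqr_ge0 (cheb_sin a k.+1).
  nra.
by rewrite chebSS; nra.
Qed.

(** * Dimension and minimal non-representable subgraphs *)

Lemma representable_leq (R : realType) (T : finType) (G : graph T) m n :
  (m <= n)%N -> representable R G m -> representable R G n.
Proof.
move=> mn [f [finj fE]]; rewrite -(subnKC mn).
exists (fun x => row_mx (f x) 0); split=> [x y xG yG /eq_row_mx[E _]|x y xy].
  exact: finj.
apply/eucl_dist_eq1; rewrite opp_row_mx add_row_mx subrr dotp_row_mx.
by rewrite (eucl_dist_eq1 _ _).1 ?fE // /dotp mul0mx mxE addr0.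
Qed.

Lemma representable_graph_dim (R : realType) (T : finType) (G : graph T) n :
  representable R G n <-> (graph_dim R G <= n)%N.
Proof.
rewrite /graph_dim; case: ex_minnP => m /asboolP Gm minm; split=> [Gn|mn].
  by apply: minm; apply/asboolP.
exact: representable_leq mn Gm.
Qed.

Lemma subgraph_trans (T : finType) (K H G : graph T) :
  subgraph K H -> subgraph H G -> subgraph K G.
Proof.
move=> [KV KE] [HV HE].
by split; [apply: subset_trans HV|apply: subset_trans HE].
Qed.

Lemma graph_eq (T : finType) (K H : graph T) :
  vertices K = vertices H -> edges K = edges H -> K = H.
Proof.
case: K H => [V E wf] [V' E' wf'] /= VV EE; subst V' E'.
by rewrite (bool_irrelevance wf wf').
Qed.

Lemma proper_subgraph_size (T : finType) (K H : graph T) :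
  proper_subgraph K H ->
  (#|vertices K| + #|edges K| < #|vertices H| + #|edges H|)%N.
Proof.
move=> [[KV KE] neq]; rewrite ltn_neqAle leq_add ?subset_leq_card // andbT.
apply/eqP => E; apply: neq.
apply: graph_eq; apply/eqP; rewrite eqEcard ?KV ?KE /=.
  by rewrite -(leq_add2r #|edges K|) E leq_add2l subset_leq_card.
by rewrite -(leq_add2l #|vertices K|) E leq_add2r subset_leq_card.
Qed.

(** Minimising the number of vertices plus edges works, as this total drops strictly on proper
    subgraphs. *)
Lemma minimal_non_representable (R : realType) (T : finType) (G : graph T) n :
  ~ representable R G n ->
  exists2 H, subgraph H G & ~ representable R H n /\
    forall K, proper_subgraph K H -> representable R K n.
Proof.
move=> Gn; pose P s := `[< exists H, [/\ subgraph H G, ~ representable R H n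
  & (#|vertices H| + #|edges H| = s)%N] >].
have exP : exists s, P s.
  by exists (#|vertices G| + #|edges G|)%N; apply/asboolP; exists G.
case: (ex_minnP exP) => s /asboolP[H [HG Hn Hs]] mins.
exists H => //; split=> //.
move=> K KH; apply: contrapT => Kn; have := proper_subgraph_size KH.
rewrite Hs ltnNge mins //; apply/asboolP; exists K; split=> //.
exact: subgraph_trans KH.1 HG.
Qed.

(** Two indices giving the same edge would be successors of each other, impossible on a cycle of
    length at least 3. *)
Lemma ordS_edge_inj n k : (2 <= k)%N ->
  injective (fun i : 'I_k.+1 =>
    [set inr i; inr (ordS i)] : {set 'I_n + 'I_k.+1}).
Proof.
move=> k2 i j /setP E; move: (E (inr i)) (E (inr j)); rewrite !inE !eqxx /=.
move=> /esym/orP[/eqP[->] //|/eqP[ij]] /orP[/eqP[->] //|/eqP[ji]].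
have := @inZp_addn_neq k i 2 k2; rewrite (addn2 i) !inZpS valZpK.
by rewrite -ji -ij eqxx.
Qed.

(* Existence of critical graphs with many edges *)
Local Close Scope ring_scope.

Theorem theorem3p7 (R : realType) (n c : nat) (hn : 2 <= n) (hc : 0 < c) :
  exists (T : finType) (H : graph T),
    [/\ dimension_critical R H, graph_dim R H = n + 2 & c < #|edges H|].
Proof.
have [k ck Tk] := @cheb_lower_bound R n.+1 c hn.
have k2 : (2 <= k.+1)%N by rewrite ltnS (leq_trans hc).
have [H HG [Hn Hmin]] := minimal_non_representable
  (@join_cycle_not_representable R n k.+1 hn k2).
have Hdim : graph_dim R H = (n + 2)%N.
  apply/eqP; rewrite eqn_leq; apply/andP; split.
    by apply/representable_graph_dim/cycle_representable.
  by rewrite addn2 ltnNge; apply/negP => /representable_graph_dim.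
(* A missing rim edge would make [H] representable in dimension n + 1. So all k + 2 > c rim edges
   survive in [H]. *)
have rim i : [set inr i; inr (ordS i)] \in edges H.
  apply: contraT => iH; case: Hn; rewrite -(addn1 n).
  exact: path_representable iH.
exists ('I_n + 'I_k.+2)%type, H; split=> //; first split.
- have := forall_inP (edges_wf H) _ (rim ord0) => /andP[sub _].
  by apply/set0Pn; exists (inr ord0); apply: (subsetP sub); rewrite !inE eqxx.
- by move=> K /Hmin/representable_graph_dim; rewrite Hdim addn2.
- apply: (@leq_trans #|'I_k.+2|); first by rewrite card_ord ltnS leqW.
  rewrite -(card_imset _ (@ordS_edge_inj n k.+1 k2)).
  by apply/subset_leq_card/subsetP => _ /imsetP[i _ ->].
Qed.
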